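(* Let $A$ and $A+\Delta A$ be real $m\times n$ matrices with $\mathrm{rank}(A)=n$ and $\|\Delta A\|_2\|A^\dagger\|_2\le 1/2$. Let $\ell_j$, $1\le j\le m$, be the leverage scores of $A$, let $\tilde{\ell}_j$, $1\le j\le m$, be the leverage scores of $A+\Delta A$ computed (in exact arithmetic) from a QR decomposition of $A+\Delta A$, and let $\epsilon_F=\|\Delta A\|_F/\|A\|_F$. Then for every $1\le j\le m$ with $\ell_j>0$, $$\frac{|\tilde{\ell}_j-\ell_j|}{\ell_j}\le 12\left(\sqrt{\frac{1-\ell_j}{\ell_j}}+3\,\frac{\kappa_2(A)\,\mathrm{sr}(A)^{1/2}}{\ell_j}\,\epsilon_F\right)\kappa_2(A)\,\mathrm{sr}(A)^{1/2}\,\epsilon_F .$$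
   Context: Leverage scores: if $A$ is a real $m\times n$ matrix with $\mathrm{rank}(A)=n$ and $Q$ is any $m\times n$ matrix whose columns form an orthonormal basis of $\mathrm{range}(A)$, the leverage scores of $A$ are $\ell_j=\|e_j^TQ\|_2^2$, $1\le j\le m$, where $e_j$ is the $j$th column of the $m\times m$ identity (this is independent of the choice of $Q$). The leverage scores computed from a thin QR decomposition $A+\Delta A=\tilde{Q}\tilde{R}$ ($\tilde{Q}$ being $m\times n$ with orthonormal columns, $\tilde{R}$ being $n\times n$ upper triangular and nonsingular) are $\tilde{\ell}_j=\|e_j^T\tilde{Q}\|_2^2$; exact arithmetic is assumed. $\|\cdot\|_2$ is the spectral norm, $\|\cdot\|_F$ the Frobenius norm, $A^\dagger$ the Moore-Penrose inverse, $\kappa_2(A)=\|A\|_2\|A^\dagger\|_2$, and $\mathrm{sr}(A)=\|A\|_F^2/\|A\|_2^2$ is the stable rank. The hypothesis implies $\mathrm{rank}(A+\Delta A)=n$. *)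

(* Defs.v *)
From mathcomp Require Import all_boot all_order all_algebra.
From mathcomp Require Import all_classical all_reals.

Set Implicit Arguments.
Unset Strict Implicit.
Unset Printing Implicit Defensive.

Import Order.TTheory GRing.Theory Num.Theory.
Local Open Scope classical_set_scope.
Local Open Scope ring_scope.

(* On a row or column vector this is the Euclidean norm. *)
Definition normF (R : realType) m n (A : 'M[R]_(m, n)) : R :=
  Num.sqrt (\sum_i \sum_j A i j ^+ 2).

Definition norm2 (R : realType) m n (A : 'M[R]_(m, n)) : R :=
  sup [set normF (A *m x) | x in [set x : 'cV[R]_n | normF x <= 1]].

Definition is_moore_penrose (R : realType) m n
    (A : 'M[R]_(m, n)) (X : 'M[R]_(n, m)) : Prop :=
  [/\ A *m X *m A = A,
      X *m A *m X = X,
      (A *m X)^T = A *m X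
    & (X *m A)^T = X *m A].

(* The default value 0 is never used: see moore_penroseP. *)
Definition moore_penrose (R : realType) m n (A : 'M[R]_(m, n)) : 'M[R]_(n, m) :=
  xget 0 [set X | is_moore_penrose A X].

Definition kappa2 (R : realType) m n (A : 'M[R]_(m, n)) : R :=
  norm2 A * norm2 (moore_penrose A).

Definition stable_rank (R : realType) m n (A : 'M[R]_(m, n)) : R :=
  normF A ^+ 2 / norm2 A ^+ 2.

(* MathComp's row-space equality on transposes: range Q = range A. *)
Definition orthonormal_range_basis (R : realType) m n
    (A Q : 'M[R]_(m, n)) : Prop :=
  Q^T *m Q = 1%:M /\ (Q^T == A^T)%MS.

(* row j Q is e_j^T Q; for Q an orthonormal basis of range A this is the j-th
   leverage score of A. *)
Definition leverage_score (R : realType) m n (Q : 'M[R]_(m, n)) (j : 'I_m) : R :=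
  normF (row j Q) ^+ 2.

Definition thin_QR (R : realType) m n
    (B Q : 'M[R]_(m, n)) (T : 'M[R]_n) : Prop :=
  [/\ B = Q *m T,
      Q^T *m Q = 1%:M,
      (forall i k : 'I_n, (k < i)%N -> T i k = 0)
    & T \in unitmx].

Section MoorePenrose.
Variable R : realType.

Lemma moore_penrose_unique m n (A : 'M[R]_(m, n)) (X Y : 'M[R]_(n, m)) :
  is_moore_penrose A X -> is_moore_penrose A Y -> X = Y.
Proof.
move=> [X1 X2 X3 X4] [Y1 Y2 Y3 Y4].
have AXY : A *m X = A *m Y.
  have XE : A *m Y *m (A *m X) = A *m X by rewrite mulmxA Y1.
  have YE : A *m X *m (A *m Y) = A *m Y by rewrite mulmxA X1.
  by rewrite -X3 -XE trmx_mul X3 Y3.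
have XAY : X *m A = Y *m A.
  have XE : X *m A *m (Y *m A) = X *m A by rewrite -mulmxA (mulmxA A) Y1.
  have YE : Y *m A *m (X *m A) = Y *m A by rewrite -mulmxA (mulmxA A) X1.
  by rewrite -X4 -XE trmx_mul X4 Y4.
by rewrite -X2 -mulmxA AXY mulmxA XAY Y2.
Qed.

Lemma mul_tr_eq0 m n (A : 'M[R]_(m, n)) : A *m A^T = 0 -> A = 0.
Proof.
move=> AA0; apply/matrixP => i j; rewrite mxE; apply/eqP.
have /matrixP/(_ i i) := AA0; rewrite !mxE => /eqP.
rewrite psumr_eq0 => [/allP/(_ j)|k _]; last by rewrite mxE -expr2 sqr_ge0.
by rewrite mem_index_enum mxE mulf_eq0 orbb => /(_ isT).
Qed.

Lemma gram_unit m n (A : 'M[R]_(m, n)) : row_free A -> A *m A^T \in unitmx.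
Proof.
move=> fA; rewrite -row_free_unit -kermx_eq0; apply/eqP/(row_free_inj fA).
rewrite mul0mx; apply: mul_tr_eq0.
by rewrite trmx_mul -mulmxA (mulmxA A) mulmxA mulmx_ker mul0mx.
Qed.

Lemma moore_penroseP m n (A : 'M[R]_(m, n)) :
  is_moore_penrose A (moore_penrose A).
Proof.
apply: xgetPex => /=.
have [r [C [F [AE uF uC]]]] : exists r (C : 'M[R]_(m, r)) (F : 'M[R]_(r, n)),
    [/\ A = C *m F, F *m F^T \in unitmx & C^T *m C \in unitmx].
  exists (\rank A), (col_base A), (row_base A); split.
  - by rewrite mulmx_base.
  - by rewrite gram_unit ?row_base_free.
  - rewrite -[X in _ *m X]trmxK gram_unit // /row_free mxrank_tr.
    exact: col_base_full.
set GF := invmx (F *m F^T); set GC := invmx (C^T *m C).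
have GFt : GF^T = GF by rewrite trmx_inv trmx_mul trmxK.
have GCt : GC^T = GC by rewrite trmx_inv trmx_mul trmxK.
exists (F^T *m GF *m (GC *m C^T)).
have AX : A *m (F^T *m GF *m (GC *m C^T)) = C *m (GC *m C^T).
  by rewrite AE -!mulmxA; congr (_ *m _); rewrite !mulmxA mulmxV // mul1mx.
have XA : (F^T *m GF *m (GC *m C^T)) *m A = F^T *m GF *m F.
  rewrite AE -!mulmxA (mulmxA C^T) (mulmxA GC) mulVmx //.
  by rewrite mul1mx.
split.
- by rewrite AX {1}AE -!mulmxA (mulmxA C^T) (mulmxA GC) mulVmx // mul1mx.
- by rewrite XA -!mulmxA (mulmxA F) (mulmxA GF) mulVmx // mul1mx.
- by rewrite AX !trmx_mul trmxK GCt mulmxA.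
- by rewrite XA !trmx_mul trmxK GFt mulmxA.
Qed.

End MoorePenrose.

(* Main.v *)
Require Import Defs.
From mathcomp Require Import all_boot all_order all_algebra.
From mathcomp Require Import all_classical all_reals.
From mathcomp Require Import ring lra.

(** Let P and P~ be the orthogonal projectors onto the ranges of A and
    B = A + dA, and split e_j = p + q with p = P e_j.  Then
    l~_j - l_j = - |p - P~ p|^2 + 2 <p, P~ q> + |P~ q|^2.
    With x = |A^+|_2 |dA|_F, writing p = A z gives
    |p - P~ p| <= |p - B z| = |dA z| <= x |p|.  The hypothesis on dA yields
    |y| <= 2 |A^+|_2 |B y| for all y, and since q is orthogonal to range A,
    writing P~ q = B y gives |P~ q|^2 = <q, B y> = <q, dA y>, so that
    |P~ q| <= 2 x |q|.  Finally x = kappa_2(A) sr(A)^(1/2) eps_F. *)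

Import Order.TTheory GRing.Theory Num.Theory.
Local Open Scope ring_scope.

(** * Cauchy-Schwarz, Frobenius norm and spectral norm *)

Section EuclideanNorm.
Set Implicit Arguments.
Unset Strict Implicit.

Variable R : realType.

Definition dotp n (u v : 'cV[R]_n) : R := (u^T *m v) 0 0.

Lemma dotpE n (u v : 'cV[R]_n) : dotp u v = \sum_i u i 0 * v i 0.
Proof. by rewrite /dotp mxE; apply: eq_bigr => i _; rewrite mxE. Qed.

Lemma dotpC n (u v : 'cV[R]_n) : dotp u v = dotp v u.
Proof. by rewrite !dotpE; apply: eq_bigr => i _; rewrite mulrC. Qed.

Lemma dotpDr n (u v w : 'cV[R]_n) : dotp u (v + w) = dotp u v + dotp u w.
Proof. by rewrite /dotp mulmxDr mxE. Qed.

Lemma dotpDl n (u v w : 'cV[R]_n) : dotp (v + w) u = dotp v u + dotp w u.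
Proof. by rewrite dotpC dotpDr !(dotpC u). Qed.

Lemma dotpBr n (u v w : 'cV[R]_n) : dotp u (v - w) = dotp u v - dotp u w.
Proof. by rewrite /dotp mulmxBr !mxE. Qed.

Lemma dotpBl n (u v w : 'cV[R]_n) : dotp (v - w) u = dotp v u - dotp w u.
Proof. by rewrite dotpC dotpBr !(dotpC u). Qed.

Lemma dotpZr n a (u v : 'cV[R]_n) : dotp u (a *: v) = a * dotp u v.
Proof. by rewrite /dotp -scalemxAr mxE. Qed.

Lemma dotpZl n a (u v : 'cV[R]_n) : dotp (a *: u) v = a * dotp u v.
Proof. by rewrite dotpC dotpZr dotpC. Qed.

Lemma dotp_mull m n (M : 'M[R]_(m, n)) u v :
  dotp (M *m u) v = dotp u (M^T *m v).
Proof. by rewrite /dotp trmx_mul mulmxA. Qed.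

Lemma dotp_ge0 n (u : 'cV[R]_n) : 0 <= dotp u u.
Proof. by rewrite dotpE sumr_ge0 // => i _; rewrite -expr2 sqr_ge0. Qed.

Lemma normF_ge0 m n (M : 'M[R]_(m, n)) : 0 <= normF M.
Proof. exact: sqrtr_ge0. Qed.

Lemma sqr_normFE m n (M : 'M[R]_(m, n)) :
  normF M ^+ 2 = \sum_i \sum_j M i j ^+ 2.
Proof.
by rewrite sqr_sqrtr // sumr_ge0 // => i _; rewrite sumr_ge0 // => k _; rewrite sqr_ge0.
Qed.

Lemma sqr_normF n (u : 'cV[R]_n) : normF u ^+ 2 = dotp u u.
Proof.
by rewrite sqr_normFE dotpE; apply: eq_bigr => i _; rewrite big_ord1 expr2.
Qed.

Lemma normF0 m n : normF (0 : 'M[R]_(m, n)) = 0.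
Proof.
rewrite /normF big1 ?sqrtr0 // => i _; rewrite big1 // => k _.
by rewrite mxE expr0n.
Qed.

Lemma normF_eq0 m n (M : 'M[R]_(m, n)) : normF M = 0 -> M = 0.
Proof.
move=> M0; have /eqP := sqr_normFE M; rewrite M0 expr0n /= eq_sym.
have ge0 i : 0 <= \sum_j M i j ^+ 2.
  by rewrite sumr_ge0 // => k _; rewrite sqr_ge0.
rewrite psumr_eq0 // => /allP Mi; apply/matrixP => i k; rewrite mxE.
have := Mi i (mem_index_enum _); rewrite /= psumr_eq0; last by move=> l _; rewrite sqr_ge0.
by move=> /allP/(_ k (mem_index_enum _)); rewrite /= sqrf_eq0 => /eqP.
Qed.

Lemma normFZ n a (u : 'cV[R]_n) : normF (a *: u) = `|a| * normF u.
Proof.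
apply/eqP; rewrite -(@eqrXn2 _ 2) ?mulr_ge0 ?normr_ge0 ?normF_ge0 //.
by rewrite exprMn !sqr_normF dotpZr dotpZl real_normK ?num_real // expr2 mulrA.
Qed.

(** For nonzero [u], the squared length of [dotp u u *: v - dotp u v *: u] is [dotp u u] times the
    gap between the two sides. *)
Lemma sqr_dotp_le n (u v : 'cV[R]_n) : dotp u v ^+ 2 <= dotp u u * dotp v v.
Proof.
have := dotp_ge0 u; rewrite le_eqVlt => /predU1P [u0|u0].
  have -> : u = 0 by apply: normF_eq0; apply/eqP; rewrite -sqrf_eq0 sqr_normF -u0.
  by rewrite /dotp trmx0 !mul0mx mxE expr0n mul0r.
have := dotp_ge0 (dotp u u *: v - dotp u v *: u).
have -> : dotp (dotp u u *: v - dotp u v *: u) (dotp u u *: v - dotp u v *: u)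
    = dotp u u * (dotp u u * dotp v v - dotp u v ^+ 2).
  by rewrite dotpBr !dotpBl !dotpZr !dotpZl (dotpC v u); ring.
by rewrite pmulr_rge0 // subr_ge0.
Qed.

Lemma dotp_le n (u v : 'cV[R]_n) : `|dotp u v| <= normF u * normF v.
Proof.
rewrite -ler_sqr ?nnegrE ?mulr_ge0 ?normF_ge0 //.
by rewrite real_normK ?num_real // exprMn !sqr_normF sqr_dotp_le.
Qed.

Lemma normFD n (u v : 'cV[R]_n) : normF (u + v) <= normF u + normF v.
Proof.
rewrite -ler_sqr ?nnegrE ?addr_ge0 ?normF_ge0 //.
rewrite sqr_normF dotpDl !dotpDr (dotpC v u) sqrrD -!sqr_normF.
have := le_trans (ler_norm _) (dotp_le u v); lra.
Qed.

(** Cauchy-Schwarz is applied to each row of [M] and the squares are summed. *)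
Lemma normF_mul_le m n (M : 'M[R]_(m, n)) (u : 'cV[R]_n) :
  normF (M *m u) <= normF M * normF u.
Proof.
rewrite -ler_sqr ?nnegrE ?mulr_ge0 ?normF_ge0 //.
rewrite exprMn !sqr_normFE mulr_suml; apply: ler_sum => i _.
rewrite big_ord1 -sqr_normFE sqr_normF.
have -> : (M *m u) i 0 = dotp (row i M)^T u.
  by rewrite /dotp trmxK -row_mul [RHS]mxE.
apply: le_trans (sqr_dotp_le _ _) _; rewrite dotpE.
by under [X in X * _]eq_bigr do rewrite !mxE -expr2.
Qed.

(** The supremum in [norm2] dominates its set only once a bound is known; the Frobenius norm
    provides one. *)
Lemma has_ubound_norm2 m n (M : 'M[R]_(m, n)) :
  has_ubound [set normF (M *m x) | x in [set x : 'cV[R]_n | normF x <= 1]]%classic.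
Proof.
exists (normF M) => _ [v /= v1 <-].
by apply: le_trans (normF_mul_le _ _) _; rewrite ler_piMr ?normF_ge0.
Qed.

Lemma norm2_le m n (M : 'M[R]_(m, n)) (u : 'cV[R]_n) :
  normF (M *m u) <= norm2 M * normF u.
Proof.
have [u0|u0] := eqVneq (normF u) 0.
  by rewrite u0 mulr0 (normF_eq0 u0) mulmx0 normF0.
have u_gt0 : 0 < normF u by rewrite lt0r u0 normF_ge0.
rewrite -ler_pdivrMr // mulrC -{1}(ger0_norm (ltW u_gt0)) -normfV -normFZ scalemxAr.
apply: (ub_le_sup (has_ubound_norm2 M)); exists ((normF u)^-1 *: u) => //=.
by rewrite normFZ normfV (ger0_norm (ltW u_gt0)) mulVf.
Qed.

Lemma norm2_ge0 m n (M : 'M[R]_(m, n)) : 0 <= norm2 M.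
Proof.
rewrite -(normF0 m 1) -(mulmx0 _ M); apply: (ub_le_sup (has_ubound_norm2 M)).
by exists 0; rewrite //= normF0.
Qed.

Lemma norm2_eq0 m n (M : 'M[R]_(m, n)) : norm2 M = 0 -> M = 0.
Proof.
move=> M0; apply/matrixP => i k; rewrite mxE.
have : M *m delta_mx k (0 : 'I_1) = 0.
  apply: normF_eq0; apply/eqP; rewrite eq_le normF_ge0 andbT.
  by rewrite (le_trans (norm2_le _ _)) // M0 mul0r.
by rewrite -colE => /matrixP/(_ i 0); rewrite !mxE.
Qed.

End EuclideanNorm.

(** * The orthogonal projector [Q *m Q^T] and its link with leverage scores *)

Section Projection.
Set Implicit Arguments.
Unset Strict Implicit.

Variables (R : realType) (m n : nat) (Q : 'M[R]_(m, n)).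
Hypothesis QQ : Q^T *m Q = 1%:M.

Lemma trmx_mul_proj (u : 'cV[R]_m) : Q^T *m (Q *m (Q^T *m u)) = Q^T *m u.
Proof. by rewrite (mulmxA Q^T) QQ mul1mx. Qed.

Lemma dotp_proj (u v : 'cV[R]_m) :
  dotp (Q *m (Q^T *m u)) (Q *m (Q^T *m v)) = dotp u (Q *m (Q^T *m v)).
Proof. by rewrite !dotp_mull trmx_mul_proj trmxK. Qed.

Lemma dotp_subproj (u : 'cV[R]_m) (y : 'cV[R]_n) :
  dotp (u - Q *m (Q^T *m u)) (Q *m y) = 0.
Proof.
by rewrite dotpC dotp_mull mulmxBr trmx_mul_proj subrr /dotp mulmx0 mxE.
Qed.

Lemma sqr_normF_subproj (u : 'cV[R]_m) :
  normF (u - Q *m (Q^T *m u)) ^+ 2 = dotp u u - dotp u (Q *m (Q^T *m u)).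
Proof.
rewrite sqr_normF dotpBr dotp_subproj subr0 dotpBl.
by rewrite (dotpC (Q *m _)).
Qed.

(** The residual is orthogonal to the range of [Q], so by Pythagoras the projection of [u] is the
    nearest point of that range. *)
Lemma normF_subproj_le (u : 'cV[R]_m) (y : 'cV[R]_n) :
  normF (u - Q *m (Q^T *m u)) <= normF (u - Q *m y).
Proof.
rewrite -ler_sqr ?nnegrE ?normF_ge0 //.
set r := u - _; have -> : u - Q *m y = r + Q *m (Q^T *m u - y).
  by rewrite mulmxBr addrA subrK.
have : dotp r (Q *m (Q^T *m u - y)) = 0 by exact: dotp_subproj.
move: (Q *m _) => w; move: r => r rw.
by rewrite !sqr_normF dotpDl !dotpDr (dotpC w r) rw addr0 add0r lerDl dotp_ge0.
Qed.

(** The projector is symmetric and idempotent: the two cross terms merge, and the terms in [p] alone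
    form minus the squared residual. *)
Lemma dotp_projD (p q : 'cV[R]_m) :
  dotp (q + p) (Q *m (Q^T *m (q + p))) - normF p ^+ 2 =
  - normF (p - Q *m (Q^T *m p)) ^+ 2 + 2 * dotp p (Q *m (Q^T *m q))
  + normF (Q *m (Q^T *m q)) ^+ 2.
Proof.
rewrite sqr_normF_subproj !sqr_normF dotp_proj !mulmxDr dotpDl !dotpDr.
rewrite -(dotp_proj q p) (dotpC (Q *m (Q^T *m q))) dotp_proj.
ring.
Qed.

(** The score is the [j]-th diagonal entry of [Q *m Q^T], a quadratic form to which [dotp_projD]
    applies. *)
Lemma leverage_scoreE (j : 'I_m) :
  leverage_score Q j = dotp (delta_mx j 0) (Q *m (Q^T *m delta_mx j 0)).
Proof.
rewrite /leverage_score sqr_normFE big_ord1 dotpC dotp_mull dotpE.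
by apply: eq_bigr => k _; rewrite -colE !mxE expr2.
Qed.

Lemma leverage_score_proj (j : 'I_m) :
  normF (Q *m (Q^T *m delta_mx j (0 : 'I_1))) ^+ 2 = leverage_score Q j.
Proof. by rewrite sqr_normF dotp_proj leverage_scoreE. Qed.

Lemma leverage_score_subproj (j : 'I_m) :
  normF (delta_mx j (0 : 'I_1) - Q *m (Q^T *m delta_mx j (0 : 'I_1))) ^+ 2
  = 1 - leverage_score Q j.
Proof.
rewrite sqr_normF_subproj leverage_scoreE; congr (_ - _).
by rewrite /dotp trmx_delta mul_delta_mx mxE !eqxx.
Qed.

End Projection.

(** * Absolute perturbation bound for leverage scores *)

Section LeveragePerturbation.
Set Implicit Arguments.
Unset Strict Implicit.

Variables (R : realType) (m n : nat) (A dA Q Qt : 'M[R]_(m, n)).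
(** [V] and [W] witness that [A] and [Q] have the same range, [T] and [S] do so for [A + dA] and
    [Qt]. *)
Variables (V W T S : 'M[R]_n).
Hypotheses (QQ : Q^T *m Q = 1%:M) (QtQt : Qt^T *m Qt = 1%:M).
Hypotheses (AE : A = Q *m V) (QE : Q = A *m W).
Hypotheses (BE : A + dA = Qt *m T) (QtE : Qt = (A + dA) *m S).
Variable mu : R.
Hypotheses (mu_ge0 : 0 <= mu) (Amu : forall y : 'cV_n, normF y <= mu * normF (A *m y)).
Hypothesis dAmu : norm2 dA * mu <= 1 / 2.

(** Since [dA *m y] is at most half as long as [A *m y], the triangle inequality bounds the length
    of [A *m y] by twice that of [(A + dA) *m y]. *)
Lemma normF_le_perturbed (y : 'cV[R]_n) :
  normF y <= 2 * mu * normF ((A + dA) *m y).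
Proof.
have dAy : normF (dA *m y) <= 1 / 2 * normF (A *m y).
  apply: le_trans (norm2_le _ _) _.
  apply: le_trans (ler_wpM2l (norm2_ge0 _) (Amu y)) _.
  by rewrite mulrA ler_wpM2r ?normF_ge0.
have : normF (A *m y) <= normF ((A + dA) *m y) + normF (dA *m y).
  have -> : A *m y = (A + dA) *m y + (-1) *: (dA *m y).
    by rewrite mulmxDl scaleN1r addrK.
  by apply: le_trans (normFD _ _) _; rewrite normFZ normrN1 mul1r.
move=> tri; apply: le_trans (Amu y) _; rewrite [2 * _]mulrC -mulrA ler_wpM2l //.
lra.
Qed.

Let x := mu * normF dA.

Lemma leverage_score_perturbation (j : 'I_m) :
  `|leverage_score Qt j - leverage_score Q j| <=
    4 * (Num.sqrt (leverage_score Q j * (1 - leverage_score Q j)) + x) * x.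
Proof.
set l := leverage_score Q j; set e : 'cV[R]_m := delta_mx j 0.
set p := Q *m (Q^T *m e); set q := e - p.
set Pp := Qt *m (Qt^T *m p); set Pq := Qt *m (Qt^T *m q).
have x_ge0 : 0 <= x by rewrite mulr_ge0 ?normF_ge0.
have p2 : normF p ^+ 2 = l by exact: leverage_score_proj.
have q2 : normF q ^+ 2 = 1 - l by exact: leverage_score_subproj.
have lE : leverage_score Qt j - l =
    - normF (p - Pp) ^+ 2 + 2 * dotp p Pq + normF Pq ^+ 2.
  by rewrite -p2 -dotp_projD // leverage_scoreE /q subrK.
have pPp : normF (p - Pp) <= x * normF p.
  set z := W *m (Q^T *m e); have pE : p = A *m z by rewrite /p {1}QE -!mulmxA.
  (* The competitor [Qt *m (T *m z)] equals [(A + dA) *m z], which differs from [p] only by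
     [dA *m z]. *)
  apply: le_trans (normF_subproj_le QtQt p (T *m z)) _.
  have -> : p - Qt *m (T *m z) = (-1) *: (dA *m z).
    by rewrite mulmxA -BE mulmxDl -pE opprD addrA subrr add0r scaleN1r.
  rewrite normFZ normrN1 mul1r; apply: le_trans (normF_mul_le _ _) _.
  by rewrite /x (mulrC mu) -mulrA ler_wpM2l ?normF_ge0 // pE Amu.
have Pqle : normF Pq <= 2 * x * normF q.
  have [->|Pq0] := eqVneq (normF Pq) 0.
    by rewrite !mulr_ge0 ?normF_ge0.
  have Pq_gt0 : 0 < normF Pq by rewrite lt0r Pq0 normF_ge0.
  set y := S *m (Qt^T *m q).
  have PqE : Pq = (A + dA) *m y by rewrite /Pq {1}QtE -!mulmxA.
  (* Multiplying by the norm of [Pq] gives its square, which is [dotp q Pq]. The part [A *m y] lies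
     in the range of [Q] and is orthogonal to [q], so only [dotp q (dA *m y)] remains. *)
  rewrite -(ler_pM2r Pq_gt0) -expr2 sqr_normF (dotp_proj QtQt) -/Pq {1}PqE.
  rewrite mulmxDl dotpDr {1}AE -mulmxA dotp_subproj // add0r.
  apply: le_trans (ler_norm _) _; apply: le_trans (dotp_le _ _) _.
  rewrite [2 * x * _]mulrC -mulrA ler_wpM2l ?normF_ge0 //.
  apply: le_trans (normF_mul_le _ _) _.
  apply: le_trans (ler_wpM2l (normF_ge0 _) (normF_le_perturbed y)) _.
  rewrite -PqE /x; lra.
have pq : Num.sqrt (l * (1 - l)) = normF p * normF q.
  by rewrite -q2 -p2 -exprMn sqrtr_sqr ger0_norm // mulr_ge0 ?normF_ge0.
have cross : `|dotp p Pq| <= 2 * x * (normF p * normF q).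
  apply: le_trans (dotp_le _ _) _.
  apply: le_trans (ler_wpM2l (normF_ge0 _) Pqle) _.
  lra.
have sq1 : normF (p - Pp) ^+ 2 <= x ^+ 2 * l.
  by rewrite -p2 -exprMn ler_sqr ?nnegrE ?mulr_ge0 ?normF_ge0.
have sq2 : normF Pq ^+ 2 <= 4 * x ^+ 2 * (1 - l).
  have -> : 4 * x ^+ 2 * (1 - l) = (2 * x * normF q) ^+ 2.
    by rewrite -q2; ring.
  by rewrite ler_sqr ?nnegrE ?mulr_ge0 ?normF_ge0.
have l_ge0 : 0 <= l by rewrite -p2 sqr_ge0.
have l_le1 : 0 <= 1 - l by rewrite -q2 sqr_ge0.
have xl : 0 <= x ^+ 2 * l by rewrite mulr_ge0 ?sqr_ge0.
have xl' : 0 <= x ^+ 2 * (1 - l) by rewrite mulr_ge0 ?sqr_ge0.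
move: cross; rewrite ler_norml => /andP[cross1 cross2].
have := sqr_ge0 (normF (p - Pp)); have := sqr_ge0 (normF Pq).
(* Above, the cross term gives the factor 4 on the root and [sq2] gives at most [4 * x ^+ 2]; below,
   the negative square costs at most [x ^+ 2]. *)
rewrite lE pq ler_norml => *; apply/andP; split; nra.
Qed.

End LeveragePerturbation.

(** * From the absolute bound to the relative one *)

Theorem theorem3p1 (R : realType) (m n : nat) (A dA : 'M[R]_(m, n))
    (Q Qt : 'M[R]_(m, n)) (Rt : 'M[R]_n)
    (hrank : \rank A = n)
    (hpert : norm2 dA * norm2 (moore_penrose A) <= 1 / 2)
    (hQ : orthonormal_range_basis A Q)
    (hQR : thin_QR (A + dA) Qt Rt)
    (j : 'I_m) (hj : 0 < leverage_score Q j) :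
  `|leverage_score Qt j - leverage_score Q j| / leverage_score Q j <=
    12 * (Num.sqrt ((1 - leverage_score Q j) / leverage_score Q j) +
          3 * (kappa2 A * Num.sqrt (stable_rank A) / leverage_score Q j) *
            (normF dA / normF A)) *
    kappa2 A * Num.sqrt (stable_rank A) * (normF dA / normF A).
Proof.
have [QQ QA] := hQ; have [BE QtQt _ Tu] := hQR.
have [/submxP [W QE] /submxP [V AE]] := andP QA.
have {}QE : Q = A *m W^T by rewrite -[LHS]trmxK QE trmx_mul trmxK.
have {}AE : A = Q *m V^T by rewrite -[LHS]trmxK AE trmx_mul trmxK.
have QtE : Qt = (A + dA) *m invmx Rt by rewrite BE mulmxK.
set mu := norm2 (moore_penrose A) in hpert *.
have mu_ge0 : 0 <= mu by exact: norm2_ge0.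
(* Full column rank lets [A] be cancelled on the left of the first Penrose identity. *)
have XA : moore_penrose A *m A = 1%:M.
  have [AXA _ _ _] := moore_penroseP A.
  have /row_free_inj fA : row_free A^T by rewrite /row_free mxrank_tr hrank.
  by apply/trmx_inj/fA; rewrite -!trmx_mul mulmxA AXA mulmx1.
have Amu (y : 'cV_n) : normF y <= mu * normF (A *m y).
  by rewrite -[y in leLHS]mul1mx -XA -mulmxA norm2_le.
(* A zero [A] would force [Q] and hence the score to vanish, against [hj]; the norms of [A] may thus
   be divided by. *)
have A0 : A != 0.
  apply: contraTneq hj => A0.
  rewrite /leverage_score (_ : row j Q = 0) ?normF0 ?expr0n ?ltxx //.
  by rewrite QE A0 mul0mx row0.
have A2_gt0 : 0 < norm2 A.
  by rewrite lt0r norm2_ge0 andbT; apply: contra_neq A0; exact: norm2_eq0.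
have AF_gt0 : 0 < normF A.
  by rewrite lt0r normF_ge0 andbT; apply: contra_neq A0; exact: normF_eq0.
have := leverage_score_perturbation QQ QtQt AE QE BE QtE mu_ge0 Amu hpert j.
have srE : Num.sqrt (stable_rank A) = normF A / norm2 A.
  by rewrite /stable_rank -expr_div_n sqrtr_sqr ger0_norm // divr_ge0 // ltW.
rewrite srE /kappa2 -/mu /=.
set l := leverage_score Q j in hj *; set x := mu * normF dA.
have x_ge0 : 0 <= x by rewrite mulr_ge0 ?normF_ge0.
have -> : Num.sqrt ((1 - l) / l) = Num.sqrt (l * (1 - l)) / l.
  have -> : (1 - l) / l = l^-1 ^+ 2 * (l * (1 - l)) by field; rewrite gt_eqF.
  by rewrite [LHS]sqrtrM ?sqr_ge0 // sqrtr_sqr gtr0_norm ?invr_gt0 // mulrC.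
have s_ge0 := sqrtr_ge0 (l * (1 - l)); set s := Num.sqrt _ in s_ge0 *.
move=> H; rewrite ler_pdivrMr //.
apply: le_trans H _.
(* The norms of [A] cancel, so the product of condition number, root of stable rank and relative
   error is exactly [x]. It remains to compare [4 * (s + x) * x] with [12 * (s + 3 * x) * x]. *)
have -> : 12 * (s / l + 3 * (norm2 A * mu * (normF A / norm2 A) / l) *
   (normF dA / normF A)) * (norm2 A * mu) * (normF A / norm2 A) *
   (normF dA / normF A) * l = 12 * (s + 3 * x) * x.
  by rewrite /x; field; rewrite !gt_eqF.
have : 0 <= s * x by rewrite mulr_ge0.
have : 0 <= x * x by rewrite mulr_ge0.
nra.
Qed.
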